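(* Let $p$ be a prime and let $G$ be a $p$-group with $|G|=p^{n}\ge p^2$. Then $\mathrm{cod}(G)=\{p^i\mid 0\le i\le n-1\}$ if and only if one of the following occurs: (1) $G\cong \mathbb{Z}_{p^{n-1}}\times \mathbb{Z}_p$; (2) $G \cong \mathbb{Z}_{p^{n-1}} \rtimes \mathbb{Z}_p$, $G$ has nilpotence class $2$, and $n\ge 4$; (3) $G$ has maximal class and $|\mathrm{cd}(G)|=2$.
   Context: All groups are finite. $\mathrm{Irr}(G)$ is the set of irreducible complex characters of $G$, and $\mathrm{cd}(G)=\{\chi(1)\mid \chi\in\mathrm{Irr}(G)\}$ is the set of character degrees. The codegree of $\chi\in\mathrm{Irr}(G)$ is $\mathrm{cod}(\chi)=|G:\ker(\chi)|/\chi(1)$, and $\mathrm{cod}(G)=\{\mathrm{cod}(\chi)\mid\chi\in\mathrm{Irr}(G)\}$. $\mathbb{Z}_m$ denotes the cyclic group of order $m$; $\mathbb{Z}_{p^{n-1}}\rtimes\mathbb{Z}_p$ denotes a semidirect product (with some action of $\mathbb{Z}_p$ on the normal factor $\mathbb{Z}_{p^{n-1}}$). A $p$-group of order $p^n$ has maximal class if its nilpotence class is $n-1$. *)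

(* Defs.v *)
From mathcomp Require Import all_boot all_order all_algebra.
From mathcomp Require Import all_fingroup all_solvable all_field all_character.

Set Implicit Arguments.
Unset Strict Implicit.
Unset Printing Implicit Defensive.

Import GroupScope GRing.Theory.
Local Open Scope ring_scope.

(* Complex irreducible characters are represented with values in algC. The    *)
(* sets cd(G) and cod(G) are duplicate-free sequences, so that size is their  *)
(* cardinality; they are to be compared with other sets by =i.                *)

Definition cd (gT : finGroupType) (G : {group gT}) : seq algC :=
  undup [seq 'chi[G]_i 1%g | i : Iirr G].

Definition codegree (gT : finGroupType) (G : {group gT}) (chi : 'CF(G)) : algC :=
  #|G : cfker chi|%g%:R / chi 1%g.

Definition cod (gT : finGroupType) (G : {group gT}) : seq algC :=
  undup [seq codegree 'chi[G]_i | i : Iirr G].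

(* In the next two predicates, 'Z_m is the cyclic group of order m only for   *)
(* m > 1.                                                                     *)
Definition isog_Zdirect (gT : finGroupType) (G : {group gT}) (m k : nat) : Prop :=
  G \isog [set: 'Z_m * 'Z_k].

(* The external semidirect product by some (possibly trivial) action of 'Z_k  *)
(* on the normal factor 'Z_m by automorphisms.                                *)
Definition isog_Zsemidirect (gT : finGroupType) (G : {group gT}) (m k : nat) : Prop :=
  exists to : groupAction [set: 'Z_k] [set: 'Z_m], G \isog [set: sdprod_by to].

(* Main.v *)
(* If G is nonabelian and p^(n-1) is a codegree, then G has a faithful         *)
(* irreducible character of degree p. Restricting it to a maximal normal       *)
(* abelian subgroup A and applying Clifford's theorem gives |G : A| = p, so    *)
(* cd(G) = {1, p}; moreover Z(G) is cyclic, so that its subgroup Z1 of order p *)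
(* lies in every nontrivial normal subgroup. All characters of codegree less   *)
(* than p^(n-1) factor through G / Z1, which therefore satisfies the same      *)
(* hypothesis, and one argues by induction on n. If G / Z1 has class at most 2 *)
(* and a cyclic maximal subgroup, then for n >= 4 so does G, as otherwise Z1   *)
(* would miss a nontrivial central cyclic subgroup; the classification of      *)
(* extremal p-groups then applies. If G / Z1 has maximal class, then           *)
(* |G : G'| = p^2, and |G'| <= |A : Z(G)| forces Z(G) = Z1, so G has maximal   *)
(* class. Conversely, the codegrees are exhibited by faithful characters of    *)
(* cyclic quotients and of quotients with cyclic center.                       *)

Require Import Defs.
From mathcomp Require Import all_boot all_order all_algebra.
From mathcomp Require Import all_fingroup all_solvable all_field all_character zify.

Set Implicit Arguments.
Unset Strict Implicit.
Unset Printing Implicit Defensive.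

Import GroupScope GRing.Theory Num.Theory archimedean.Num.Theory.
Local Open Scope ring_scope.

Implicit Types gT : finGroupType.

(** If |G| = p^n and an irreducible character has codegree p^a, degree p^b and kernel of order p^k,
    then a + b + k = n ([codegree_pgroup]). So a = n forces a faithful linear character, hence a
    cyclic group ([cod_noncyclic]), and a = n - 1 leaves two cases. If b = 0 and k = 1, the quotient
    by the kernel is cyclic of order p^(n-1): in an abelian group this gives an element of order
    p^(n-1) that splits off, and a nonabelian group excludes it because the kernel is central. So a
    nonabelian group has a faithful character of degree p, hence a cyclic centre and an abelian
    subgroup A of index p ([abelian_prime_index_fful]), and its degrees are 1 and p.

    Let Z1 be the subgroup of order p of the cyclic centre. Passing to G / Z1 removes exactly the
    top codegree ([cod_quotient_Ohm1_center]). The induction carries a dichotomy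
    ([cod_cyclic_maximal_or_maxclass]): a cyclic maximal subgroup and class at most 2, or maximal
    class. The first case climbs back to G by [cyclic_prime_index_lift] and the classification of
    p-groups with a cyclic maximal subgroup, the second by [maxclass_quotient_Ohm1_center].

    Conversely, a cyclic quotient of order p^m gives all p^i with i <= m ([expr_mem_cod_cyclic]),
    and faithful characters of degree p give the remaining codegrees, in G itself or, for maximal
    class, in its successive quotients by centres ([maxclass_mem_cod]). *)

(** * Codegrees of quotients, and their arithmetic in p-groups *)

Lemma codegree_mod gT (G N : {group gT}) (i : Iirr (G / N)) :
  N <| G -> codegree 'chi_(mod_Iirr i) = codegree 'chi_i.
Proof.
move=> nsNG; rewrite /codegree mod_IirrE // cfMod1.
have kerN := cfker_mod 'chi_i nsNG.
rewrite -[in RHS](cfModK nsNG 'chi_i) cfker_quo // cfModK //.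
by rewrite index_quotient_eq ?cfker_sub ?normal_norm // subIset ?kerN ?orbT.
Qed.

Lemma mem_cod gT (G : {group gT}) i : codegree 'chi[G]_i \in cod G.
Proof. by rewrite mem_undup; apply: map_f; rewrite mem_enum. Qed.

Lemma codP gT (G : {group gT}) x : reflect (exists i, x = codegree 'chi[G]_i) (x \in cod G).
Proof.
by rewrite mem_undup; apply: (iffP imageP) => [[i _ ->]|[i ->]]; exists i.
Qed.

Lemma cod_quotient gT (G N : {group gT}) : N <| G -> {subset cod (G / N) <= cod G}.
Proof. by move=> nsNG _ /codP[i ->]; rewrite -codegree_mod ?mem_cod. Qed.

Lemma irr1_pgroup gT (p : nat) (G : {group gT}) (i : Iirr G) :
  prime p -> p.-group G -> exists k, 'chi_i 1%g = (p ^ k)%:R.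
Proof.
move=> p_pr /p_natP[n oG]; have := dvd_irr1_cardG i.
rewrite irr1_degree dvdC_nat oG.
by case/dvdn_pfactor=> // k _ ->; exists k.
Qed.

Lemma codegree_fful_lin gT (G : {group gT}) (i : Iirr G) :
  cfaithful 'chi_i -> 'chi_i \is a linear_char -> codegree 'chi_i = #|G|%:R.
Proof.
by rewrite /codegree => /trivgP-> /lin_char1->; rewrite indexg1 divr1.
Qed.

Lemma card_cyclic_mem_cod gT (p : nat) (G : {group gT}) :
  p.-group G -> cyclic G -> #|G|%:R \in cod G.
Proof.
move=> pG cycG; have [|i fful_i] := pgroup_cyclic_faithful pG.
  by rewrite (cyclicS (center_sub G)).
by rewrite -(codegree_fful_lin fful_i) ?mem_cod ?irr_cyclic_lin.
Qed.

(** A cyclic p-group has a faithful linear character, of codegree the group order; this is applied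
    to the quotient of order p^i of G / N. *)
Lemma expr_mem_cod_cyclic (p m i : nat) gT (G N : {group gT}) :
    prime p -> p.-group G -> N <| G -> cyclic (G / N) -> #|G : N| = (p ^ m)%N ->
  (i <= m)%N -> (p ^ i)%:R \in cod G.
Proof.
move=> p_pr pG nsNG cycGN iGN le_im; apply: (cod_quotient nsNG).
have pGN := quotient_pgroup N pG.
have oGN: #|(G / N)%g| = (p ^ m)%N by rewrite card_quotient ?normal_norm.
have [|Q [sQ nsQ oQ]] := normal_pgroup (r := m - i) pGN (normal_refl _).
  by rewrite oGN pfactorK // leq_subr.
apply: (cod_quotient nsQ).
have <-: #|(G / N / Q)%g| = (p ^ i)%N.
  rewrite card_quotient ?normal_norm // -divgS // oGN oQ.
  by rewrite -expnB ?leq_subr ?prime_gt0 // subKn.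
apply: (@card_cyclic_mem_cod _ p); first exact: quotient_pgroup.
exact: quotient_cyclic.
Qed.

Lemma mem_expr_iota (p n : nat) (x : algC) :
  reflect (exists2 i, (i < n)%N & x = (p ^ i)%:R) (x \in [seq (p ^ i)%:R | i <- iota 0 n]).
Proof.
apply: (iffP mapP) => [[i]|[i lt_in ->]]; last by exists i; rewrite ?mem_iota.
by rewrite mem_iota => /andP[_ lt_in] ->; exists i.
Qed.

Lemma codegree_mulr gT (G : {group gT}) i :
  codegree 'chi[G]_i * 'chi_i 1%g * #|cfker 'chi_i|%:R = #|G|%:R.
Proof.
by rewrite /codegree divfK ?irr1_neq0 // -natrM mulnC Lagrange ?cfker_sub.
Qed.

Lemma lin_char_cyclic_quotient gT (G : {group gT}) (i : Iirr G) :
  'chi_i \is a linear_char -> cyclic (G / cfker 'chi_i).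
Proof.
move=> lin_i; suff ->: (G / cfker 'chi_i = 'Z('chi_i)%CF / cfker 'chi_i)%g.
  exact: cfcenter_cyclic.
rewrite cfcenter_eq_center; apply/esym/center_idP.
by rewrite sub_der1_abelian // lin_char_der1.
Qed.

(** The codegree is an integer because the degree divides the index of the centre of the character,
    which divides the index of its kernel. *)
Lemma codegree_pgroup (p n : nat) gT (G : {group gT}) (i : Iirr G) :
    prime p -> #|G| = (p ^ n)%N ->
  exists a b k : nat, [/\ codegree 'chi_i = (p ^ a)%:R, 'chi_i 1%g = (p ^ b)%:R,
                 #|cfker 'chi_i| = (p ^ k)%N & (a + b + k)%N = n].
Proof.
move=> p_pr oG; have pG: p.-group G by rewrite /pgroup oG pnatX pnat_id ?orbT.
have [b chi1] := irr1_pgroup i p_pr pG.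
have /p_natP[k ok]: p.-nat #|cfker 'chi_i| := pgroupS (cfker_sub _) pG.
have /p_natP[m iG]: p.-nat #|G : cfker 'chi_i| := pnat_dvd (dvdn_indexg _ _) pG.
have:= codegree_mulr i; rewrite chi1 ok /codegree iG chi1.
have p0 j: (p ^ j)%:R != 0 :> algC by rewrite pnatr_eq0 expn_eq0 negb_and -lt0n prime_gt0.
have le_bm: (b <= m)%N.
  have:= dvd_irr1_index_center i; rewrite chi1 dvdC_nat => dvd_b.
  have := dvdn_trans dvd_b (indexgS G (normal_sub (cfker_center_normal 'chi_i))).
  by rewrite iG dvdn_Pexp2l ?prime_gt1.
have mE: (p ^ m = p ^ (m - b) * p ^ b)%N by rewrite -expnD subnK.
rewrite mE natrM mulfK // -!natrM -!expnD => /eqP; rewrite eqr_nat oG.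
rewrite eqn_exp2l ?prime_gt1 // => /eqP def_n.
by exists (m - b)%N, b, k; split=> //; rewrite natrM mulfK.
Qed.

Lemma cod_noncyclic (p n : nat) gT (G : {group gT}) :
    prime p -> #|G| = (p ^ n)%N ->
  {subset cod G <= [seq (p ^ i)%:R | i <- iota 0 n]} <-> ~~ cyclic G.
Proof.
move=> p_pr oG; have pG: p.-group G by rewrite /pgroup oG pnatX pnat_id ?orbT.
have p_gt1 := prime_gt1 p_pr.
split=> [cod_lt | ncG x /codP[i ->]].
  apply/negP=> /(card_cyclic_mem_cod pG)/cod_lt/mem_expr_iota[i lt_in] /eqP.
  by rewrite oG eqr_nat eqn_exp2l // gtn_eqF.
have [a [b [k [-> chi1 ok def_n]]]] := codegree_pgroup i p_pr oG.
apply/mem_expr_iota; exists a => //; rewrite -def_n -addnA -addn1 leq_add2l.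
rewrite lt0n addn_eq0; apply: contra ncG => /andP[/eqP b0 /eqP k0].
have lin_i: 'chi_i \is a linear_char by rewrite qualifE /= irr_char chi1 b0 /=.
have /trivgP ker1: cfaithful 'chi_i by rewrite /cfaithful subG1 trivg_card1 ok k0.
by have := lin_char_cyclic_quotient lin_i; rewrite ker1 -(isog_cyclic (quotient1_isog G)).
Qed.

(** * Clifford theory for a faithful character of degree p *)

(** A maximal normal abelian A is its own centralizer. By Clifford, the restriction to A is e times
    a sum of |G : T| conjugates of a linear character with inertia group T, so |G : T| divides p.
    Faithfulness makes T centralize A, whence T = A; index 1 would make the character linear. *)
Lemma abelian_prime_index_fful gT (p : nat) (G : {group gT}) (i : Iirr G) :
    prime p -> p.-group G -> cfaithful 'chi_i -> 'chi_i 1%g = p%:R ->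
  exists A : {group gT}, [/\ A <| G, abelian A & #|G : A| = p].
Proof.
move=> p_pr pG fful_i chi1.
have [A maxA _]: {A : {group gT} | [max A | A <| G & abelian A] & 1%G \subset A}.
  by apply: maxgroup_exists; rewrite normal1 abelian1.
have scA := max_SCN pG maxA; have cAA := SCN_abelian scA.
have [nsAG defA] := SCN_P scA; have [sAG nAG] := andP nsAG.
exists A; split=> //.
have [j jP]: exists j, j \in irr_constt ('Res[A] 'chi_i).
  by apply/neq0_has_constt; rewrite Res_irr_neq0.
have lin_j: 'chi_j \is a linear_char by apply/char_abelianP.
have defRes := Clifford_Res_sum_cfclass nsAG jP.
set e := '[_, _] in defRes; set T := 'I_G['chi_j]%g.
(* Used at 1 to compute the degree, then at [[~ a, t]] to place it in the kernel. *)
have res1 x : x \in A -> (forall y, y \in G -> ('chi_j ^ y)%CF x = 1) ->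
    'chi_i x = e * #|G : T|%:R.
  move=> Ax x1; rewrite -(cfResE _ sAG Ax) defRes cfunE sum_cfunE -size_cfclass.
  congr (_ * _); rewrite (eq_big_seq (fun=> 1)) ?big_const_seq ?count_predT ?iter_addr_0 //.
  by move=> _ /cfclassP[y Gy ->]; apply: x1.
have chi1E: 'chi_i 1%g = e * #|G : T|%:R.
  by apply: res1 => // y _; rewrite lin_char1 ?cfConjg_lin_char.
have iT: #|G : T| \in [:: 1%N; p].
  have /natrP[d ed]: e \in Num.nat by rewrite Cnat_cfdot_char_irr ?cfRes_char ?irr_char.
  have: (#|G : T| %| p)%N.
    by apply/dvdnP; exists d; apply/eqP; rewrite -(eqr_nat algC) natrM -ed -chi1E chi1.
  by rewrite !inE; case/primeP: p_pr => _ /[apply].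
have nsTG: T <| G.
  move: iT; rewrite !inE => /orP[/eqP iT1 | /eqP iTp].
    suffices ->: T = G by apply: normal_refl.
    by apply/eqP; rewrite eqEsubset Inertia_sub -indexg_eq1 iT1.
  by rewrite (p_maximal_normal pG) // p_index_maximal ?Inertia_sub ?iTp.
have defT: T = A.
  apply/eqP; rewrite eqEsubset sub_Inertia // andbT.
  suffices: T \subset 'C_G(A) by rewrite defA.
  rewrite subsetI Inertia_sub; apply/centsP=> t Tt a Aa; apply/commute_sym/commgP.
  have Gt: t \in G := subsetP (Inertia_sub _ _) t Tt.
  have Aat: [~ a, t] \in A by rewrite groupM ?groupV ?memJ_norm ?(subsetP nAG).
  (* T is normal, so it fixes every conjugate of 'chi_j; these are linear,
     hence all trivial at [~ a, t]. *)
  suffices: [~ a, t] \in cfker 'chi_i by rewrite (trivgP fful_i) => /set1P->.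
  rewrite cfkerEirr inE chi1E res1 // => y Gy.
  have Ty: t \in 'I[('chi_j ^ y)%CF]%g.
    rewrite -conjg_inertia ?(subsetP nAG) //.
    have: t \in T :^ y by rewrite (normsP (normal_norm nsTG)).
    by rewrite !mem_conjg inE => /andP[].
  have lin_y := cfConjg_lin_char y lin_j.
  rewrite commgEl lin_charM ?groupV ?memJ_norm ?(subsetP nAG) //.
  by rewrite (inertia_valJ _ Ty) lin_charV // mulVf ?lin_char_neq0.
move: iT; rewrite defT !inE => /orP[|/eqP //]; rewrite indexg_eq1 => sGA.
have /lin_char1: 'chi_i \is a linear_char.
  by apply/char_abelianP; apply: abelianS cAA.
by move/eqP; rewrite chi1 (eqr_nat _ _ 1) => /eqP p1; rewrite p1 in p_pr.
Qed.

(** * Centre and derived subgroup of p-groups *)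

Section PGroups.

Local Open Scope nat_scope.
Local Open Scope group_scope.

Lemma center_sub_abelian_prime_index gT (G A : {group gT}) :
    ~~ abelian G -> abelian A -> A \subset G -> prime #|G : A| ->
  'Z(G) \subset A.
Proof.
move=> ncG cAA sAG /(p_index_maximal sAG)/maxgroupP[_ maxA].
apply: contraR ncG => not_sZA; pose B := (A <*> 'Z(G))%G.
have sBG: B \subset G by rewrite join_subG sAG center_sub.
have [ltBG | ] := boolP (B \proper G).
  by case/negP: not_sZA; rewrite -(maxA B ltBG) ?joing_subl ?joing_subr.
rewrite properE sBG /= negbK => sGB; apply: abelianS sGB _.
by rewrite abelianY cAA center_abelian subIset // centS ?orbT.
Qed.

(** For y outside A, a |-> [a, y] is an endomorphism of the normal abelian group A, and the index of
    its kernel is the order of its image. *)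
Lemma leq_der1_abelian_prime_index gT (G A : {group gT}) :
    ~~ abelian G -> abelian A -> A <| G -> prime #|G : A| ->
  #|G^`(1)| <= #|A : 'Z(G)|.
Proof.
move=> ncG cAA nsAG pr_iA; have [sAG nAG] := andP nsAG.
have [y Gy notAy]: exists2 y, y \in G & y \notin A.
  by apply/subsetPn; rewrite -indexg_eq1 gtn_eqF ?prime_gt1.
have defG: A <*> <[y]> = G.
  have [_ maxA] := maxgroupP (p_index_maximal sAG pr_iA).
  apply/eqP; rewrite eqEsubset join_subG sAG cycle_subG Gy /=.
  apply: contraR notAy => not_sG; rewrite -cycle_subG.
  rewrite -(maxA (A <*> <[y]>)%G) ?joing_subl ?joing_subr //.
  by rewrite properE not_sG join_subG sAG cycle_subG Gy.
have nAy := subsetP nAG y Gy.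
have memR a : a \in A -> [~ a, y] \in A.
  by move=> Aa; rewrite commgEl groupM ?groupV ?memJ_norm.
have comA := centsP cAA.
have fM: {in A &, {morph (fun a => [~ a, y]) : a b / a * b}}.
  move=> a b Aa Ab; rewrite /= commMgJ; congr (_ * _).
  by apply/conjg_fixP/commgP/comA; rewrite ?memR.
(* G' is contained in the image of f, whose kernel is 'Z(G). *)
pose f := Morphism fM.
have sfA: f @* A \subset A.
  by apply/subsetP=> _ /morphimP[a _ Aa ->]; apply: memR.
have memf a : a \in A -> [~ a, y] \in f @* A.
  by move=> Aa; apply: (mem_morphim f).
have nfy: y \in 'N(f @* A).
  rewrite inE; apply/subsetP=> _ /imsetP[_ /morphimP[a _ Aa ->] ->] /=.
  by rewrite conjRg (conjgE y y) mulKg memf ?memJ_norm.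
have nfG: G \subset 'N(f @* A).
  by rewrite -defG join_subG cycle_subG nfy andbT cents_norm // (centSS _ sfA cAA).
(* Modulo the image, y commutes with A, so G = A<y> becomes abelian. *)
have sG'f: G^`(1) \subset f @* A.
  apply: (der1_min (H := (f @* A)%G)) => //; rewrite -defG quotientY ?cycle_subG ?(subset_trans sAG) //.
  rewrite abelianY !quotient_abelian ?cycle_abelian //=.
  rewrite quotient_cycle // cycle_subG; apply/centP=> _ /morphimP[a na Aa ->].
  apply/commgP; rewrite -morphR //; apply/eqP/coset_id.
  by rewrite -invg_comm groupV memf.
apply: leq_trans (subset_leq_card sG'f) _.
rewrite card_morphim setIid; have ->: 'ker f = 'Z(G); last by [].
have sZA := center_sub_abelian_prime_index ncG cAA sAG pr_iA.
apply/setP=> a; apply/idP/idP=> [/morphpreP[Aa /set1P/eqP/commgP cay] | Za].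
  rewrite inE (subsetP sAG) //= -sub_cent1 -defG join_subG cycle_subG.
  by rewrite sub_cent1 (subsetP cAA) // cent1C; apply/cent1P.
have [Ga /centP cGa] := setIP Za.
apply/morphpreP; split; first exact: (subsetP sZA).
by apply/set1P/eqP/commgP/cGa.
Qed.

(** With |Z(G)| = p^z, the noncyclic quotient G / Z(G) has order p^(n-z) >= p^2, hence class at most
    n - z - 1; but its class is n - 2. *)
Lemma maxclass_card_center gT (p : nat) n (G : {group gT}) :
    prime p -> #|G| = (p ^ n)%N -> 2 < n -> nil_class G = n.-1 ->
  #|'Z(G)| = p.
Proof.
move=> p_pr oG n_gt2 clG.
have pG: p.-group G by rewrite /pgroup oG pnatX pnat_id.
have nilG := pgroup_nil pG.
have ncG: ~~ abelian G by rewrite -nil_class1 clG -ltnNge -(subnKC n_gt2).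
have /p_natP[z oZ]: p.-nat #|'Z(G)| := pgroupS (center_sub G) pG.
have ntZ: 'Z(G) != 1.
  by apply: contraNneq ncG => /(trivg_center_pgroup pG)->; apply: abelian1.
have z_gt0: 0 < z by rewrite lt0n; apply: contraNneq ntZ => z0; rewrite trivg_card1 oZ z0.
have oGZ: #|G / 'Z(G)| = (p ^ (n - z))%N.
  rewrite card_quotient ?gFnorm // -divgS ?center_sub // oG oZ -expnB ?prime_gt0 //.
  by rewrite -(leq_exp2l _ _ (prime_gt1 p_pr)) -oG -oZ subset_leq_card ?center_sub.
have ncGZ: ~~ cyclic (G / 'Z(G)).
  by apply: contra ncG => /cyclic_center_factor_abelian.
have nz_gt1: 1 < n - z.
  rewrite ltnNge; apply: contra ncGZ => nz_le1.
  case: (n - z) nz_le1 oGZ => [|[|//]] _ oGZ; first by rewrite (card1_trivg oGZ) cyclic1.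
  by rewrite prime_cyclic ?oGZ.
have:= nil_class_pgroup (quotient_pgroup 'Z(G) pG).
rewrite nil_class_quotient_center // clG oGZ pfactorK //.
by move=> le_n; have z1: z = 1%N by [lia]; rewrite oZ z1.
Qed.

(** Induction modulo Z(G), which has order p and lies in G', down to the abelian case of order
    p^2. *)
Lemma maxclass_index_der1 gT (p : nat) n (G : {group gT}) :
    prime p -> #|G| = (p ^ n)%N -> 1 < n -> nil_class G = n.-1 ->
  #|G : G^`(1)| = (p ^ 2)%N.
Proof.
move=> p_pr; case: n => [|[|n]] // oG _.
elim: n gT G oG => [|n IHn] gT G oG clG.
  by have /derG1P->: abelian G; rewrite -?nil_class1 ?clG // indexg1 oG.
have pG: p.-group G by rewrite /pgroup oG pnatX pnat_id.
have nilG := pgroup_nil pG.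
have oZ := maxclass_card_center p_pr oG isT clG.
have ncG: ~~ abelian G by rewrite -nil_class1 clG.
have sZG': 'Z(G) \subset G^`(1).
  apply: prime_meetG; rewrite ?oZ // setIC meet_center_nil ?der_normal //.
  by apply: contraNneq ncG => /derG1P.
have oGZ: #|G / 'Z(G)| = (p ^ n.+2)%N.
  rewrite card_quotient ?gFnorm // -divgS ?center_sub // oG oZ.
  by rewrite expnS mulKn ?prime_gt0.
have nZG: G \subset 'N('Z(G)) := gFnorm _ _.
have sGZ: G :&: 'Z(G) \subset G^`(1) by rewrite subIset ?sZG' ?orbT.
rewrite -(index_quotient_eq sGZ (der_sub 1 G) nZG) quotient_der //.
by apply: IHn; rewrite ?nil_class_quotient_center ?clG.
Qed.

(** Nontrivial normal subgroups of a p-group meet its centre, and a cyclic centre has only one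
    subgroup of order p. *)
Lemma Ohm1_center_sub_normal gT (p : nat) (G N : {group gT}) :
    p.-group G -> cyclic 'Z(G) -> N <| G -> N :!=: 1 ->
  'Ohm_1('Z(G)) \subset N.
Proof.
move=> pG cycZ nsNG ntN; have tiNZ := meet_center_nil (pgroup_nil pG) nsNG ntN.
have ntZ: 'Z(G) != 1 by apply: contraNneq tiNZ => ->; rewrite setIg1.
have pZ := pgroupS (center_sub G) pG.
apply: prime_meetG.
  rewrite (Ohm1_cyclic_pgroup_prime cycZ pZ ntZ).
  by have [] := pgroup_pdiv pZ ntZ.
by apply: contraNneq tiNZ; rewrite setIC => /TI_Ohm1->.
Qed.

End PGroups.

(** * Lifting a cyclic maximal subgroup from a central quotient *)

Section CyclicMaximalLift.

Local Open Scope nat_scope.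
Local Open Scope group_scope.

(** Lift the generator to x. If Z1 lies in <x>, the order of x is p^(n-1). Otherwise A = <x> Z1 is
    abelian of index p, and x^p turns out to be central and nontrivial, so that <x^p> contains Z1, a
    contradiction. *)
Lemma cyclic_prime_index_lift gT (p n : nat) (G : {group gT})
    (xbar : coset_of 'Ohm_1('Z(G))) (Z1 := 'Ohm_1('Z(G))%G) :
    prime p -> #|G| = (p ^ n)%N -> 3 < n -> cyclic 'Z(G) ->
    xbar \in G / Z1 -> #[xbar] = (p ^ n.-2)%N -> nil_class (G / Z1) <= 2 ->
  exists2 x, x \in G & #[x] = (p ^ n.-1)%N.
Proof.
move=> p_pr oG n_gt3 cycZ Gx ox cl2.
have [n_gt0 e2 n2_gt1]: [/\ 0 < n, n.-2.+1 = n.-1 & 1 < n.-2] by split; lia.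
have pG: p.-group G by rewrite /pgroup oG pnatX pnat_id.
have pZ := pgroupS (center_sub G) pG.
have ntG: G :!=: 1 by rewrite -cardG_gt1 oG (ltn_exp2l 0) ?prime_gt1.
have ntZ: 'Z(G) != 1 by apply: contraNneq ntG => /(trivg_center_pgroup pG)->.
have oZ1: #|Z1| = p := Ohm1_cyclic_pgroup_prime cycZ pZ ntZ.
have sZ1Z: Z1 \subset 'Z(G) := Ohm_sub 1 _.
have nsZ1G: Z1 <| G by rewrite sub_center_normal.
have [sZ1G nZ1G] := andP nsZ1G.
case/morphimP: Gx => x nZ1x Gx def_x; exists x => //.
have nsC: <[x]> \subset 'N(Z1) by rewrite cycle_subG.
have def_xbar: <[xbar]> = <[x]> / Z1 by rewrite def_x quotient_cycle.
have [sZ1x | tiZ1x] := boolP (Z1 \subset <[x]>).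
  rewrite orderE -(Lagrange sZ1x) oZ1 -card_quotient // -def_xbar -orderE ox.
  by rewrite -expnS e2.
have {}tiZ1x: <[x]> :&: Z1 = 1 by rewrite setIC prime_TIg ?oZ1.
have o_x: #[x] = (p ^ n.-2)%N.
  by rewrite -ox !orderE def_xbar -(card_isog (quotient_isog nsC _)) // setIC.
pose A := (<[x]> <*> Z1)%G.
have sXG: <[x]> \subset G by rewrite cycle_subG.
have cXZ1: Z1 \subset 'C(<[x]>).
  by rewrite (subset_trans sZ1Z) // subIset // centS ?orbT.
have cAA: abelian A.
  by rewrite abelianY cycle_abelian (abelianS sZ1Z) ?center_abelian.
have defA: A :=: <[x]> * Z1 by apply: cent_joinEr.
have sAG: A \subset G by rewrite join_subG sXG.
have Ax: x \in A by rewrite mem_gen // inE cycle_id.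
have oA: #|A| = (p ^ n.-1)%N.
  by rewrite defA TI_cardMg // -orderE o_x oZ1 -expnSr e2.
have iA: #|G : A| = p.
  rewrite -divgS // oG oA -expnB ?prime_gt0 ?leq_pred //.
  by rewrite -[in n - _](prednK n_gt0) subSnn.
have nsAG: A <| G.
  by rewrite (p_maximal_normal pG) // p_index_maximal ?iA.
have nAG := normal_norm nsAG.
(* [x^p, y] = [x, y]^p lies in <x>, since [x, y] = u z with u in <x> and z^p = 1. It also lies in
   Z1: modulo Z1, class at most 2 turns it into [x, y^p], trivial as y^p is in A. These subgroups
   meet trivially. *)
have xpZ y : y \in G -> [~ x ^+ p, y] = 1.
  move=> Gy; have nAy := subsetP nAG y Gy.
  have Ac: [~ x, y] \in A by rewrite commgEl groupM ?groupV ?memJ_norm.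
  have /set1P: [~ x ^+ p, y] \in [1 gT]; last by [].
  rewrite -tiZ1x commXg; last exact: (centsP cAA).
  apply/setIP; split.
    have: [~ x, y] \in <[x]> * Z1 by rewrite -defA.
    case/mulsgP=> u z Xu Z1z ->.
    rewrite expgMn; last by apply/commute_sym/(centsP cXZ1).
    have ->: z ^+ p = 1 by rewrite -oZ1 expg_cardG.
    by rewrite mulg1 groupX.
  have Nxy: [~ x, y] \in 'N(Z1) by rewrite (subsetP nZ1G) ?groupR.
  apply: coset_idr; first by rewrite groupX.
  have nZ1y := subsetP nZ1G y Gy.
  have ypA: y ^+ p \in A.
    apply: coset_idr; first by rewrite groupX.
    by rewrite morphX // -iA -card_quotient // expg_cardG // mem_quotient.
  rewrite morphX // morphR // -commgX.
    rewrite -morphX // -morphR ?groupX //.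
    suffices /eqP->: [~ x, y ^+ p] == 1 by rewrite morph1.
    exact/commgP/(centsP cAA).
  move: cl2; rewrite nil_class2 => sG'Z.
  have /(subsetP sG'Z)/centerP[_ cG'] : [~ coset Z1 x, coset Z1 y] \in (G / Z1)^`(1).
    by rewrite mem_commg ?mem_quotient.
  by apply/commute_sym/cG'/mem_quotient.
have Zxp: x ^+ p \in 'Z(G).
  by apply/centerP; split=> [|y Gy]; [rewrite groupX | apply/commgP/eqP/xpZ].
have nsXpG: <[x ^+ p]> <| G by rewrite sub_center_normal ?cycle_subG.
(* This is where 3 < n matters: x has order p^(n-2) > p. *)
have ntXp: <[x ^+ p]> != 1.
  rewrite cycle_eq1 -order_dvdn o_x -[X in _ %| X]expn1 dvdn_Pexp2l ?prime_gt1 //.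
  by rewrite -ltnNge.
have sZ1Xp := Ohm1_center_sub_normal pG cycZ nsXpG ntXp.
have /eqP := prime_gt1 p_pr; rewrite -oZ1 -/Z1.
suffices ->: Z1 :=: 1 by rewrite cards1.
apply/trivgP; rewrite -tiZ1x subsetI subxx andbT.
by rewrite (subset_trans sZ1Xp) // cycle_subG mem_cycle.
Qed.

End CyclicMaximalLift.

(** * Nonabelian p-groups with a cyclic maximal subgroup *)

Section CyclicMaximal.

Local Open Scope nat_scope.
Local Open Scope group_scope.

(** [Extremal.gtype] is built on the cycles generated by 1, which equal the full groups ['Z_p] and
    ['Z_q] only by a proof; the action is transported along such equalities. *)
Lemma groupAction_dom_range (aT rT : finGroupType) (D D' : {group aT})
    (R R' : {group rT}) (to : groupAction D R) : D = D' -> R = R' ->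
  exists to' : groupAction D' R', [set: sdprod_by to] \isog [set: sdprod_by to'].
Proof. by case: D' / ; case: R' /; exists to; apply: isog_refl. Qed.

Lemma extremal_gtype_sdprod q p e :
  exists to : groupAction [set: 'Z_p] [set: 'Z_q],
    [set: Extremal.gtype q p e] \isog [set: sdprod_by to].
Proof.
rewrite Extremal.gtype.unlock.
by apply: groupAction_dom_range; apply/val_inj/esym/Zp_cycle.
Qed.

Lemma modular_isog_Zsemidirect gT (p n : nat) (G : {group gT}) :
  prime p -> 2 < n -> G \isog 'Mod_(p ^ n) -> isog_Zsemidirect G (p ^ n.-1) p.
Proof.
move=> p_pr n_gt2; rewrite /modular_gtype.
have [n_gt0 n1] : 0 < n /\ n = n.-1.+1 by lia.
rewrite n1 pdiv_pfactor // expnS mulKn ?prime_gt0 //.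
have [to isoto] := extremal_gtype_sdprod (p ^ n.-1) p (p ^ n.-1 %/ p).+1.
by move=> isoG; exists to; apply: isog_trans isoG isoto.
Qed.

(** By classification, either G is modular, or p = 2 and G is dihedral, semidihedral or quaternion,
    hence of maximal class. *)
Lemma cyclic_maximal_nonabelian gT (p n : nat) (G : {group gT}) x :
    prime p -> #|G| = (p ^ n)%N -> ~~ abelian G -> x \in G ->
    #[x] = (p ^ n.-1)%N ->
  nil_class G = 2 /\ isog_Zsemidirect G (p ^ n.-1) p \/ nil_class G = n.-1.
Proof.
move=> p_pr oG ncG Gx ox.
have pG: p.-group G by rewrite /pgroup oG pnatX pnat_id.
have p_gt1 := prime_gt1 p_pr.
have n_gt2: 2 < n.
  rewrite ltnNge; apply: contra ncG => n_le2.
  by rewrite (p2group_abelian pG) // oG pfactorK.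
have n_gt0: 0 < n by lia.
have sXG: <[x]> \subset G by rewrite cycle_subG.
have iX: #|G : <[x]>| = p.
  rewrite -divgS // oG -orderE ox -expnB ?prime_gt0 ?leq_pred //.
  by rewrite -[in n - _](prednK n_gt0) subSnn.
case/orP: (maximal_cycle_extremal pG ncG (cycle_cyclic x) sXG iX).
  move/eqP/modular_group_classP=> [q q_pr [m m_ge isoG]].
  have m_gt2: 2 < m by lia.
  have [[u v] genG modG] := generators_modular_group q_pr m_gt2 isoG.
  have [_ _ [_ _ cl2] _ _] := modular_group_structure q_pr m_gt2 genG isoG modG.
  have [oGq _ _ _] := genG.
  have qp: q = p.
    have : q \in primes #|G| by rewrite oGq primesX ?primes_prime ?inE //; lia.
    by rewrite oG primesX ?primes_prime ?inE // => /eqP.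
  move: oG; rewrite oGq qp => /eqP; rewrite eqn_exp2l // => /eqP def_m.
  by left; split=> //; apply: modular_isog_Zsemidirect; rewrite -?def_m // -qp.
case/andP=> /eqP p2; rewrite /extremal2 !inE => extG; right.
have inj2 m : #|G| = (2 ^ m)%N -> m = n.
  by rewrite oG p2 => /eqP; rewrite eqn_exp2l // => /eqP.
case/or3P: extG => /eqP.
- case/dihedral_classP=> m m_gt1 isoG.
  have [[u v] genG _] := generators_2dihedral m_gt1 isoG.
  have [_ [_ _ _ ->] _ _ _] := dihedral2_structure m_gt1 genG isoG.
  by have [/inj2->] := genG.
- case/semidihedral_classP=> m m_gt3 isoG.
  have [[u v] genG [ov _]] := generators_semidihedral m_gt3 isoG.
  have [_ [_ _ _ ->] _ _ _] := semidihedral_structure m_gt3 genG isoG ov.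
  by have [/inj2->] := genG.
case/quaternion_classP=> m m_gt2 isoG.
have [[u v] genG _] := generators_quaternion m_gt2 isoG.
have [_ [_ _ _ ->] _ _ _] := quaternion_structure m_gt2 genG isoG.
by have [/inj2->] := genG.
Qed.

End CyclicMaximal.

(** * Degrees over an abelian subgroup, and the codegree p^(n-1) *)

(** By Frobenius reciprocity, the character is a constituent of one induced from a linear character
    of A. *)
Lemma irr1_le_abelian_index gT (G A : {group gT}) (i : Iirr G) :
  A \subset G -> abelian A -> 'chi_i 1%g <= #|G : A|%:R.
Proof.
move=> sAG cAA.
have [j jP]: exists j, j \in irr_constt ('Res[A] 'chi_i).
  by apply/neq0_has_constt; rewrite Res_irr_neq0.
have lin_j: 'chi_j \is a linear_char by apply/char_abelianP.
have: 'chi_i 1%g <= ('Ind[G] 'chi_j) 1%g.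
  by rewrite char1_ge_constt ?cfInd_char ?irr_char // constt_Ind_Res.
by rewrite cfInd1 // (lin_char1 lin_j) mulr1.
Qed.

Lemma irr1_abelian_prime_index gT (p : nat) (G A : {group gT}) (i : Iirr G) :
    prime p -> p.-group G -> A \subset G -> abelian A -> #|G : A| = p ->
  'chi_i 1%g = (if 'chi_i \is a linear_char then 1 else p)%:R.
Proof.
move=> p_pr pG sAG cAA iA; case: ifPn => [/lin_char1-> // | nlin_i].
have := irr1_le_abelian_index i sAG cAA; rewrite iA.
have [k chi1] := irr1_pgroup i p_pr pG; rewrite chi1 ler_nat => le_k1.
case: k => [|k] in chi1 le_k1 *.
  by case/negP: nlin_i; rewrite qualifE /= irr_char chi1 /=.
by move: le_k1; rewrite -[X in (_ <= X)%N]expn1 leq_exp2l ?prime_gt1 //; case: k {chi1}.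
Qed.

Lemma size_cd_abelian_prime_index gT (p : nat) (G A : {group gT}) :
    prime p -> p.-group G -> ~~ abelian G -> A \subset G -> abelian A ->
    #|G : A| = p ->
  size (cd G) = 2%N.
Proof.
move=> p_pr pG ncG sAG cAA iA.
have irr1 i := irr1_abelian_prime_index i p_pr pG sAG cAA iA.
have [i nlin_i]: exists i : Iirr G, 'chi_i \isn't a linear_char.
  apply/existsP; apply: contraR ncG => /existsPn lin.
  by apply/char_abelianP=> i; have := lin i; rewrite negbK.
suffices: perm_eq (cd G) [:: 1; p%:R] by move/perm_size.
apply: uniq_perm; rewrite ?undup_uniq //=.
  by rewrite inE eq_sym (eqr_nat _ p 1) gtn_eqF ?prime_gt1.
move=> x; rewrite mem_undup !inE; apply/imageP/idP=> [[j _ ->] | ].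
  by rewrite irr1; case: ifP; rewrite eqxx ?orbT.
case/orP=> /eqP->; first by exists 0; rewrite ?irr0 ?cfun11.
by exists i; rewrite // irr1 (negPf nlin_i).
Qed.

(** A linear character with kernel of order p gives a cyclic quotient, whose generator lifts to an
    element of order p^(n-1) or p^n; the latter would make G cyclic. *)
Lemma abelian_cod_expr_pred gT (p n : nat) (G : {group gT}) :
    prime p -> #|G| = (p ^ n)%N -> (0 < n)%N -> abelian G -> ~~ cyclic G ->
    (p ^ n.-1)%:R \in cod G ->
  exists2 x, x \in G & #[x]%g = (p ^ n.-1)%N.
Proof.
move=> p_pr oG n_gt0 cGG ncG /codP[i cod_i]; have p_gt1 := prime_gt1 p_pr.
have [a [b [k [def_a chi1 ok def_n]]]] := codegree_pgroup i p_pr oG.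
have lin_i: 'chi_i \is a linear_char by apply/char_abelianP.
have b0: b = 0%N.
  move: chi1; rewrite lin_char1 // => /eqP; rewrite eq_sym (eqr_nat _ _ 1).
  by rewrite -(expn0 p) eqn_exp2l // => /eqP.
have a_n: a = n.-1.
  by move: cod_i; rewrite def_a => /eqP; rewrite eqr_nat eqn_exp2l // => /eqP.
have [xbar defGK] := cyclicP (lin_char_cyclic_quotient lin_i).
have: xbar \in (G / cfker 'chi_i)%g by rewrite defGK cycle_id.
case/morphimP=> x Nx Gx def_x; exists x => //.
have: (p ^ n.-1 %| #[x]%g)%N.
  have: (#[xbar]%g %| #[x]%g)%N by rewrite def_x morph_order.
  apply: dvdn_trans; rewrite orderE -defGK.
  rewrite card_quotient ?cfker_norm // -divgS ?cfker_sub // oG ok.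
  by rewrite -expnB ?prime_gt0 //; [rewrite dvdn_exp2l //; lia | lia].
have: (#[x]%g %| p ^ n)%N by rewrite -oG order_dvdG.
case/dvdn_pfactor=> // m le_mn ox; rewrite ox dvdn_Pexp2l // => le_nm.
have lt_mn: m != n.
  apply: contra ncG => /eqP m_n; apply/cyclicP; exists x; apply/eqP.
  by rewrite eq_sym eqEcard cycle_subG Gx oG -orderE ox m_n /=.
by congr (p ^ _)%N; lia.
Qed.

Lemma nonabelian_cod_expr_pred gT (p n : nat) (G : {group gT}) :
    prime p -> #|G| = (p ^ n)%N -> (0 < n)%N -> ~~ abelian G ->
    (p ^ n.-1)%:R \in cod G ->
  exists2 i : Iirr G, cfaithful 'chi_i & 'chi_i 1%g = p%:R.
Proof.
move=> p_pr oG n_gt0 ncG /codP[i cod_i]; have p_gt1 := prime_gt1 p_pr.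
have pG: p.-group G by rewrite /pgroup oG pnatX pnat_id.
have [a [b [k [def_a chi1 ok def_n]]]] := codegree_pgroup i p_pr oG.
have a_n: a = n.-1.
  by move: cod_i; rewrite def_a => /eqP; rewrite eqr_nat eqn_exp2l // => /eqP.
have [[b1 k0] | [b0 k1]]: b = 1%N /\ k = 0%N \/ b = 0%N /\ k = 1%N by lia.
  exists i; last by rewrite chi1 b1 expn1.
  by rewrite /cfaithful subG1 trivg_card1 ok k0.
(* Here the kernel has order p, so it is central, and the cyclic quotient by it would make G
   abelian. *)
have lin_i: 'chi_i \is a linear_char by rewrite qualifE /= irr_char chi1 b0 /=.
case/negP: ncG; apply: cyclic_factor_abelian (lin_char_cyclic_quotient lin_i).
have ok1: #|cfker 'chi_i| = p by rewrite ok k1 expn1.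
apply: prime_meetG; rewrite ?ok1 //.
apply: (meet_center_nil (pgroup_nil pG) (cfker_normal _)).
by rewrite -cardG_gt1 ok1.
Qed.

(** * Induction through the quotient by the socle of the centre *)

(** A character whose kernel does not contain Z1 is faithful, of degree at most |G : A| = p, so its
    codegree is at least p^(n-1). *)
Lemma cod_quotient_Ohm1_center gT (p n : nat) (G : {group gT}) :
    prime p -> #|G| = (p ^ n)%N -> (0 < n)%N -> ~~ abelian G ->
    cod G =i [seq (p ^ i)%:R | i <- iota 0 n] ->
  cod (G / 'Ohm_1('Z(G)))%G =i [seq (p ^ i)%:R | i <- iota 0 n.-1].
Proof.
move=> p_pr oG n_gt0 ncG codG; have p_gt1 := prime_gt1 p_pr.
have pG: p.-group G by rewrite /pgroup oG pnatX pnat_id.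
have [i0 fful_i0 chi01]: exists2 i : Iirr G, cfaithful 'chi_i & 'chi_i 1%g = p%:R.
  apply: (nonabelian_cod_expr_pred p_pr oG n_gt0 ncG).
  by rewrite codG; apply/mem_expr_iota; exists n.-1; rewrite ?ltn_predL.
have cycZ := irr_faithful_center fful_i0.
have [A [nsAG cAA iA]] := abelian_prime_index_fful p_pr pG fful_i0 chi01.
have pZ := pgroupS (center_sub G) pG.
have ntZ: 'Z(G) != 1%g.
  by apply: contraNneq ncG => /(trivg_center_pgroup pG)->; apply: abelian1.
pose Z1 := 'Ohm_1('Z(G))%G.
have oZ1: #|Z1| = p := Ohm1_cyclic_pgroup_prime cycZ pZ ntZ.
have sZ1Z: Z1 \subset 'Z(G) := Ohm_sub 1 _.
have nsZ1G: Z1 <| G by rewrite sub_center_normal.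
have oGZ1: #|(G / Z1)%g| = (p ^ n.-1)%N.
  rewrite card_quotient ?normal_norm // -divgS ?normal_sub // oG oZ1.
  by rewrite -(prednK n_gt0) expnS mulKn ?prime_gt0.
move=> x; apply/idP/idP.
  apply: (proj2 (cod_noncyclic p_pr oGZ1)).
  by apply: contra ncG => /(cyclic_factor_abelian sZ1Z).
case/mem_expr_iota=> a lt_an ->.
have: (p ^ a)%:R \in cod G.
  by rewrite codG; apply/mem_expr_iota; exists a => //; apply: leq_trans lt_an (leq_pred n).
case/codP=> i cod_i.
have sZ1K: Z1 \subset cfker 'chi_i.
  apply: (Ohm1_center_sub_normal pG cycZ (cfker_normal _)).
  apply: contraTneq lt_an => ker1; rewrite -leqNgt.
  have [a' [b [k [def_a chi1 ok def_n]]]] := codegree_pgroup i p_pr oG.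
  have a'a: a' = a.
    by move: cod_i; rewrite def_a => /eqP; rewrite eqr_nat eqn_exp2l // => /eqP.
  have k0: k = 0%N.
    by move: ok; rewrite ker1 cards1 => /esym/eqP; rewrite -(expn0 p) eqn_exp2l // => /eqP.
  have := irr1_le_abelian_index i (normal_sub nsAG) cAA.
  rewrite chi1 iA ler_nat -[X in (_ <= X)%N -> _]expn1 leq_exp2l //.
  by rewrite -def_n k0 addn0 a'a -subn1 leq_subLR addnC leq_add2r.
by rewrite cod_i -(quo_IirrK nsZ1G sZ1K) codegree_mod ?mem_cod.
Qed.

Lemma cod_pgroup_structure gT (p n : nat) (G : {group gT}) :
    prime p -> #|G| = (p ^ n)%N -> (1 < n)%N -> ~~ abelian G ->
    cod G =i [seq (p ^ i)%:R | i <- iota 0 n] ->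
  [/\ size (cd G) = 2%N, cyclic 'Z(G)
    & exists A : {group gT}, [/\ A <| G, abelian A & #|G : A| = p]].
Proof.
move=> p_pr oG n_gt1 ncG codG.
have pG: p.-group G by rewrite /pgroup oG pnatX pnat_id.
have [i fful_i chi1]: exists2 i : Iirr G, cfaithful 'chi_i & 'chi_i 1%g = p%:R.
  apply: (nonabelian_cod_expr_pred p_pr oG (ltnW n_gt1) ncG).
  by rewrite codG; apply/mem_expr_iota; exists n.-1; rewrite // ltn_predL ltnW.
have [A [nsAG cAA iA]] := abelian_prime_index_fful p_pr pG fful_i chi1.
split; [|exact: irr_faithful_center fful_i | by exists A].
exact: size_cd_abelian_prime_index p_pr pG ncG (normal_sub nsAG) cAA iA.
Qed.

Section Maxclass.
Local Open Scope nat_scope.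
Local Open Scope group_scope.

(** Maximal class of G / Z1 gives |G : G'| = p^2. With |G| = p |A : Z(G)| |Z(G)| and |G'| <= |A :
    Z(G)| this yields |Z(G)| <= p, so Z1 is the whole centre. *)
Lemma maxclass_quotient_Ohm1_center gT (p n : nat) (G A : {group gT})
    (Z1 := 'Ohm_1('Z(G))) :
    prime p -> #|G| = (p ^ n)%N -> 2 < n -> ~~ abelian G -> cyclic 'Z(G) ->
    A <| G -> abelian A -> #|G : A| = p -> nil_class (G / Z1) = n.-2 ->
  nil_class G = n.-1.
Proof.
move=> p_pr oG n_gt2 ncG cycZ nsAG cAA iA clGZ1.
have [n1_gt1 e1 e2]: [/\ 1 < n.-1, n = n.-1.+1 & n.-1 = n.-2.+1] by split; lia.
have p_gt1 := prime_gt1 p_pr; have p_gt0 := prime_gt0 p_pr.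
have pG: p.-group G by rewrite /pgroup oG pnatX pnat_id.
have nilG := pgroup_nil pG.
have pZ := pgroupS (center_sub G) pG.
have ntZ: 'Z(G) != 1%g.
  by apply: contraNneq ncG => /(trivg_center_pgroup pG)->; apply: abelian1.
have oZ1: #|Z1| = p := Ohm1_cyclic_pgroup_prime cycZ pZ ntZ.
have sZ1Z: Z1 \subset 'Z(G) := Ohm_sub 1 _.
have nsZ1G: Z1 <| G by rewrite sub_center_normal.
have [sZ1G nZ1G] := andP nsZ1G.
have oGZ1: #|G / Z1| = (p ^ n.-1)%N.
  by rewrite card_quotient // -divgS // oG oZ1 [in LHS]e1 expnS mulKn.
have ntG': G^`(1) != 1 by apply: contraNneq ncG => /derG1P.
have sZ1G' := Ohm1_center_sub_normal pG cycZ (der_normal 1 G) ntG'.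
have iG': #|G : G^`(1)| = (p ^ 2)%N.
  have sGZ1: G :&: Z1 \subset G^`(1) by rewrite subIset ?sZ1G' ?orbT.
  rewrite -(index_quotient_eq sGZ1 (der_sub 1 G) nZ1G) quotient_der //.
  exact: maxclass_index_der1 p_pr oGZ1 n1_gt1 clGZ1.
have leG' := leq_der1_abelian_prime_index ncG cAA nsAG.
rewrite iA in leG'; have {}leG' := leG' p_pr.
have sAG := normal_sub nsAG.
have sZA: 'Z(G) \subset A.
  by apply: center_sub_abelian_prime_index; rewrite ?iA.
have leZp: #|'Z(G)| <= p.
  have G'_gt0: 0 < #|G^`(1)| by [].
  rewrite -(leq_pmul2r G'_gt0).
  have defp: (p * #|A : 'Z(G)| * #|'Z(G)|)%N = (p * p * #|G^`(1)|)%N.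
    have <-: #|G| = (p * #|A : 'Z(G)| * #|'Z(G)|)%N.
      by rewrite -mulnA (mulnC #|A : _|) Lagrange // -iA mulnC Lagrange.
    by rewrite mulnn -iG' mulnC Lagrange ?der_sub.
  rewrite -(leq_pmul2l p_gt0) [leqRHS]mulnA -defp -mulnA leq_pmul2l //.
  by rewrite mulnC leq_pmul2r.
have defZ: Z1 :=: 'Z(G) by apply/eqP; rewrite eqEcard sZ1Z oZ1.
have := nil_class_quotient_center nilG; rewrite -defZ clGZ1.
move=> cl_pred; rewrite e2 cl_pred prednK // lt0n nil_class0.
by apply: contraNneq ncG => ->; apply: abelian1.
Qed.

End Maxclass.

(** The bound on the class is part of the induction because the lift from G / Z1 relies on it. *)
Lemma cod_cyclic_maximal_or_maxclass gT (p n : nat) (G : {group gT}) :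
    prime p -> #|G| = (p ^ n)%N -> (1 < n)%N ->
    cod G =i [seq (p ^ i)%:R | i <- iota 0 n] ->
  (exists2 x, x \in G & #[x]%g = (p ^ n.-1)%N) /\ (nil_class G <= 2)%N
    \/ nil_class G = n.-1.
Proof.
move=> p_pr; have p_gt1 := prime_gt1 p_pr.
elim: n gT G => // n IHn gT G oG n_gt1 codG.
have pG: p.-group G by rewrite /pgroup oG pnatX pnat_id.
have cod_pred: (p ^ n)%:R \in cod G.
  by rewrite codG; apply/mem_expr_iota; exists n.
have [cGG | ncG] := boolP (abelian G).
  left; split; last by rewrite (leq_trans _ (leqnSn 1)) // nil_class1.
  apply: (abelian_cod_expr_pred p_pr oG) => //.
  by apply/(cod_noncyclic p_pr oG) => x; rewrite codG.
have n_gt1': (1 < n)%N.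
  rewrite ltnNge; apply: contra ncG => n_le1.
  by rewrite (p2group_abelian pG) // oG pfactorK.
have [_ cycZ [A [nsAG cAA iA]]] := cod_pgroup_structure p_pr oG n_gt1 ncG codG.
have codQ := cod_quotient_Ohm1_center p_pr oG (ltn0Sn n) ncG codG.
have oQ: #|(G / 'Ohm_1('Z(G)))%g| = (p ^ n)%N.
  have pZ := pgroupS (center_sub G) pG.
  have ntZ: 'Z(G) != 1%g.
    by apply: contraNneq ncG => /(trivg_center_pgroup pG)->; apply: abelian1.
  have nsZ1G: 'Ohm_1('Z(G))%G <| G by rewrite sub_center_normal ?Ohm_sub.
  rewrite card_quotient ?normal_norm // -divgS ?normal_sub // oG.
  by rewrite (Ohm1_cyclic_pgroup_prime cycZ pZ ntZ) expnS mulKn ?prime_gt0.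
have [[[x Gx ox] cl2] | clQ] := IHn _ _ oQ n_gt1' codQ; last first.
  by right; apply: maxclass_quotient_Ohm1_center p_pr oG _ ncG cycZ nsAG cAA iA clQ.
(* Here |G| = p^3, too small for the lift, but a nonabelian group of this order has maximal
   class. *)
have [n3 | n_neq2] := eqVneq n 2.
  right; rewrite n3 in oG *; apply/eqP; rewrite eqn_leq [(1 < _)%N]ltnNge nil_class1 ncG andbT.
  by have := nil_class_pgroup pG; rewrite oG pfactorK.
have n_gt3: (3 < n.+1)%N by lia.
have [y Gy oy] := cyclic_prime_index_lift p_pr oG n_gt3 cycZ Gx ox cl2.
have [[clG _] | ->] := cyclic_maximal_nonabelian p_pr oG ncG Gy oy; last by right.
by left; split; [exists y | rewrite clG].
Qed.

(** * External products of cyclic groups and their internal forms *)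

Section ZpProducts.

Local Open Scope nat_scope.
Local Open Scope group_scope.

Lemma cyclic_sdprod_transport gT rT m k (G : {group gT}) (L C Y : {group rT}) :
    G \isog L -> C ><| Y = L -> cyclic C -> cyclic Y -> #|C| = m -> #|Y| = k ->
  exists C' Y' : {group gT},
    [/\ C' ><| Y' = G, cyclic C', cyclic Y', #|C'| = m & #|Y'| = k].
Proof.
rewrite isog_sym => /isogP[f injf <-] defL cycC cycY oC oY.
have [/normal_sub sCL sYL _ _ _] := sdprod_context defL.
exists (f @* C)%G, (f @* Y)%G.
by rewrite (injm_sdprod (subxx L) injf defL) !morphim_cyclic ?card_injm.
Qed.

Lemma setT_Zp_cyclic m : cyclic [set: 'Z_m].
Proof. by rewrite Zp_cycle cycle_cyclic. Qed.

Lemma card_setT_Zp m : 1 < m -> #|[set: 'Z_m]| = m.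
Proof. by move=> m_gt1; rewrite cardsT card_ord Zp_cast. Qed.

Lemma isog_Zsemidirect_sdprod gT m k (G : {group gT}) :
    1 < m -> 1 < k -> isog_Zsemidirect G m k ->
  exists C Y : {group gT},
    [/\ C ><| Y = G, cyclic C, cyclic Y, #|C| = m & #|Y| = k].
Proof.
move=> m_gt1 k_gt1 [to isoG].
apply: (cyclic_sdprod_transport isoG (sdprod_sdpair to));
  by rewrite ?morphim_cyclic ?card_injm ?injm_sdpair1 ?injm_sdpair2
             ?setT_Zp_cyclic ?card_setT_Zp.
Qed.

Lemma setT_Zdirect m k :
  setX [set: 'Z_m] 1 \x setX 1 [set: 'Z_k] = [set: 'Z_m * 'Z_k].
Proof. by rewrite setX_dprod; apply/setP=> u; rewrite !inE. Qed.

Lemma isog_Zdirect_sdprod gT m k (G : {group gT}) :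
    1 < m -> 1 < k -> isog_Zdirect G m k ->
  abelian G /\ exists C Y : {group gT},
    [/\ C ><| Y = G, cyclic C, cyclic Y, #|C| = m & #|Y| = k].
Proof.
move=> m_gt1 k_gt1 isoG; have defL := setT_Zdirect m k.
have cycC: cyclic (setX [set: 'Z_m] (1 : {set 'Z_k})).
  by rewrite -morphim_pairg1 morphim_cyclic ?setT_Zp_cyclic.
have cycY: cyclic (setX (1 : {set 'Z_m}) [set: 'Z_k]).
  by rewrite -morphim_pair1g morphim_cyclic ?setT_Zp_cyclic.
split.
  rewrite (isog_abelian isoG) -(dprodW defL) abelianM !cyclic_abelian //=.
  by have [_ _ cCY _] := dprodP defL.
apply: (cyclic_sdprod_transport isoG (dprodWsd defL)) => //.
  by rewrite cardsX cards1 muln1 card_setT_Zp.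
by rewrite cardsX cards1 mul1n card_setT_Zp.
Qed.

Lemma dprod_isog_Zdirect gT m k (G C Y : {group gT}) :
    1 < m -> 1 < k -> C \x Y = G -> cyclic C -> cyclic Y ->
    #|C| = m -> #|Y| = k ->
  isog_Zdirect G m k.
Proof.
move=> m_gt1 k_gt1 defG cycC cycY oC oY.
apply: (isog_dprod defG (setT_Zdirect m k)).
  apply: isog_trans (isog_setX1 _ _).
  by rewrite isog_cyclic_card ?setT_Zp_cyclic ?card_setT_Zp ?oC /=.
apply: isog_trans (isog_set1X _ _).
by rewrite isog_cyclic_card ?setT_Zp_cyclic ?card_setT_Zp ?oY /=.
Qed.

(** As G is not cyclic, the order of x is the exponent, so <x> has a complement, of order p. *)
Lemma abelian_maximal_exponent_isog gT (p n : nat) (G : {group gT}) x :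
    prime p -> #|G| = (p ^ n)%N -> 1 < n -> abelian G -> ~~ cyclic G ->
    x \in G -> #[x] = (p ^ n.-1)%N ->
  isog_Zdirect G (p ^ n.-1) p.
Proof.
move=> p_pr oG n_gt1 cGG ncG Gx ox; have p_gt1 := prime_gt1 p_pr.
have pG: p.-group G by rewrite /pgroup oG pnatX pnat_id.
have n1_gt0: 0 < n.-1 by rewrite -subn1 subn_gt0.
have expG: #[x] = exponent G.
  have [y Gy oy] := exponent_witness (pgroup_nil pG).
  have: #[y] %| p ^ n by rewrite -oG order_dvdG.
  case/dvdn_pfactor=> // m le_mn def_y.
  have: #[x] %| #[y] by rewrite -oy dvdn_exponent.
  rewrite oy ox def_y dvdn_Pexp2l // => le_nm; congr (p ^ _)%N.
  have neq_mn: m != n.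
    apply: contra ncG => /eqP def_m; apply/cyclicP; exists y; apply/eqP.
    by rewrite eq_sym eqEcard cycle_subG Gy oG -orderE def_y def_m /=.
  by move: le_mn le_nm neq_mn; clear; lia.
have /splitsP[Y /complP[tiXY defG]] := abelian_splits Gx expG cGG.
have oY: #|Y| = p.
  have pn: (p ^ n = p ^ n.-1 * p)%N by rewrite -expnSr prednK // ltnW.
  have pn1_gt0: 0 < (p ^ n.-1)%N by rewrite expn_gt0 (ltnW p_gt1).
  apply/eqP; rewrite -(eqn_pmul2l pn1_gt0) -pn -oG -ox orderE.
  by rewrite -(TI_cardMg tiXY) defG.
apply: (@dprod_isog_Zdirect _ _ _ G <[x]>%G Y) => //.
- by rewrite -(expn0 p) ltn_exp2l.
- rewrite dprodE //; apply: sub_abelian_cent2 cGG _ _; rewrite -defG.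
    exact: mulG_subr.
  exact: mulG_subl.
- exact: cycle_cyclic.
by rewrite prime_cyclic ?oY.
Qed.

End ZpProducts.

(** * Codegrees of the three families *)

Lemma cod_eq_noncyclic gT (p n : nat) (G : {group gT}) :
    prime p -> #|G| = (p ^ n)%N -> ~~ cyclic G ->
    (forall i, (i < n)%N -> (p ^ i)%:R \in cod G) ->
  cod G =i [seq (p ^ i)%:R | i <- iota 0 n].
Proof.
move=> p_pr oG ncG le_cod x; apply/idP/idP.
  exact: (proj2 (cod_noncyclic p_pr oG)).
by case/mem_expr_iota=> i lt_in ->; apply: le_cod.
Qed.

Section CodegreesOfGroups.

Local Open Scope nat_scope.
Local Open Scope group_scope.

(** The quotient G / Y, isomorphic to C, supplies all the codegrees. *)
Lemma cod_abelian_sdprod gT (p n : nat) (G C Y : {group gT}) :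
    prime p -> #|G| = (p ^ n)%N -> 1 < n -> abelian G ->
    C ><| Y = G -> cyclic C -> cyclic Y -> #|C| = (p ^ n.-1)%N -> #|Y| = p ->
  cod G =i [seq ((p ^ i)%:R)%R | i <- iota 0 n].
Proof.
move=> p_pr oG n_gt1 cGG defG cycC cycY oC oY; have p_gt1 := prime_gt1 p_pr.
have pG: p.-group G by rewrite /pgroup oG pnatX pnat_id.
have [nsCG sYG _ _ tiCY] := sdprod_context defG.
have defGx: C \x Y = G.
  rewrite dprodEsd ?defG //.
  exact: sub_abelian_cent2 cGG sYG (normal_sub nsCG).
have n1_gt0: 0 < n.-1 by rewrite -subn1 subn_gt0.
have ncG: ~~ cyclic G.
  rewrite (cyclic_dprod defGx) // oC oY coprime_pexpl // prime_coprime //.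
  by rewrite dvdnn.
apply: cod_eq_noncyclic => // i lt_in.
have nsYG: Y <| G by rewrite -sub_abelian_normal.
have defGC: Y ><| C = G by apply: dprodWsdC.
apply: (@expr_mem_cod_cyclic p n.-1 i _ G Y) => //.
- by rewrite -(isog_cyclic (sdprod_isog defGC)).
- by rewrite -(index_sdprod defGC).
by rewrite -ltnS (ltn_predK n_gt1).
Qed.

Lemma cod_class2_sdprod gT (p n : nat) (G C Y : {group gT}) :
    prime p -> #|G| = (p ^ n)%N -> nil_class G = 2 ->
    C ><| Y = G -> cyclic C -> cyclic Y -> #|C| = (p ^ n.-1)%N -> #|Y| = p ->
  cod G =i [seq ((p ^ i)%:R)%R | i <- iota 0 n].
Proof.
move=> p_pr oG clG defG cycC cycY oC oY; have p_gt1 := prime_gt1 p_pr.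
have pG: p.-group G by rewrite /pgroup oG pnatX pnat_id.
have ncG: ~~ abelian G by rewrite -nil_class1 clG.
have [nsCG sYG mulCY _ tiCY] := sdprod_context defG.
have sCG := normal_sub nsCG.
have cCC := cyclic_abelian cycC.
have iC: #|G : C| = p by rewrite -(index_sdprod defG).
have n_gt0: 0 < n.
  by rewrite lt0n; apply: contraNneq ncG => n0; rewrite (card1_trivg (G := G)) ?abelian1 // oG n0.
have ncyG: ~~ cyclic G by apply: contra ncG; apply: cyclic_abelian.
apply: cod_eq_noncyclic => // i lt_in.
have [i_n | neq_in] := eqVneq i n.-1.
  (* The cyclic centre provides a faithful character, of degree p because C is abelian of index
     p. *)
  have sZC: 'Z(G) \subset C by apply: center_sub_abelian_prime_index; rewrite ?iC.
  have [j fful_j] := pgroup_cyclic_faithful pG (cyclicS sZC cycC).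
  have nlin_j: 'chi_j \isn't a linear_char.
    apply: contra ncyG => /lin_char_cyclic_quotient; rewrite (trivgP fful_j).
    by rewrite -(isog_cyclic (quotient1_isog G)).
  have := mem_cod j; rewrite /codegree (trivgP fful_j) indexg1 oG.
  rewrite (irr1_abelian_prime_index j p_pr pG sCG cCC iC) (negPf nlin_j).
  rewrite i_n -[in (p ^ n)%N](prednK n_gt0) expnSr natrM mulfK //.
  by rewrite pnatr_eq0 -lt0n prime_gt0.
have [x defC] := cyclicP cycC; have [y defY] := cyclicP cycY.
have defGxy: <[x]> <*> <[y]> = G by rewrite -defC -defY (sdprodWY defG).
have sG'Z: G^`(1) \subset 'Z(G) by rewrite -nil_class2 clG.
have Gx: x \in G by rewrite (subsetP sCG) // defC cycle_id.
have Gy: y \in G by rewrite (subsetP sYG) // defY cycle_id.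
have Zxy: [~ x, y] \in 'Z(G) by rewrite (subsetP sG'Z) ?mem_commg.
have [_ cGxy] := setIP Zxy.
have defG': G^`(1) = <[[~ x, y]]>.
  by rewrite -{1}defGxy; apply: der1_joing_cycles; rewrite defGxy.
have oxy: #|G^`(1)| %| p.
  rewrite defG' -orderE order_dvdn -commgX; last exact/commute_sym/(centP cGxy).
  by rewrite -oY defY -orderE expg_order commg1.
(* G / N is a cyclic image of C. Since |N| <= p^2, it supplies every exponent up to n - 2. *)
pose N := (G^`(1) <*> Y)%G.
have sNG: N \subset G by rewrite join_subG der_sub.
have nsNG: N <| G by rewrite sub_der1_normal ?joing_subl.
have nNC: C \subset 'N(N) := subset_trans sCG (normal_norm nsNG).
have nNY: Y \subset 'N(N) := subset_trans sYG (normal_norm nsNG).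
have cycGN: cyclic (G / N).
  rewrite -mulCY quotientMl // (quotientS1 (joing_subr _ _)) mulg1.
  exact: quotient_cyclic.
have oN: #|N| <= (p ^ 2)%N.
  rewrite /= norm_joinEr; last exact: subset_trans sYG (normal_norm (der_normal 1 G)).
  apply: leq_trans (_ : #|G^`(1)| * #|Y| <= _)%N.
    by rewrite mul_cardG leq_pmulr ?cardG_gt0.
  by rewrite oY leq_mul2r dvdn_leq ?orbT ?prime_gt0.
have /p_natP[m iN]: p.-nat #|G : N| := pnat_dvd (dvdn_indexg _ _) pG.
have /p_natP[r oNr]: p.-nat #|N| := pgroupS sNG pG.
apply: (@expr_mem_cod_cyclic p m i _ G N) => //.
have def_n: (r + m)%N = n.
  have := Lagrange sNG; rewrite oNr iN oG -expnD => /eqP.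
  by rewrite eqn_exp2l // => /eqP.
have le_r2: r <= 2 by rewrite -(leq_exp2l _ _ p_gt1) -oNr.
by move: lt_in neq_in def_n le_r2; clear; lia.
Qed.

(** The nonlinear degree d is kept as a parameter because it passes unchanged to G / Z(G). It is
    identified only at order p^3, where d^2 <= |G : Z(G)| = p^2. A faithful character then gives the
    top codegree at each order. *)
Lemma maxclass_mem_cod gT (p n d : nat) (G : {group gT}) :
    prime p -> #|G| = (p ^ n)%N -> 2 < n -> nil_class G = n.-1 ->
    (forall i : Iirr G, 'chi_i \is a linear_char \/ 'chi_i 1 = d%:R%R) ->
  d = p /\ forall i, 1 < i < n -> ((p ^ i)%:R)%R \in cod G.
Proof.
move=> p_pr; have p_gt1 := prime_gt1 p_pr.
elim: n gT G => // n IHn gT G oG n_gt2 clG irr_d.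
have pG: p.-group G by rewrite /pgroup oG pnatX pnat_id.
have oZ := maxclass_card_center p_pr oG n_gt2 clG.
have ncG: ~~ abelian G by rewrite -nil_class1 clG -ltnNge.
have cycZ: cyclic 'Z(G) by rewrite prime_cyclic ?oZ.
have [j fful_j] := pgroup_cyclic_faithful pG cycZ.
have nlin_j: 'chi_j \isn't a linear_char.
  apply: contra ncG => /lin_char_cyclic_quotient; rewrite (trivgP fful_j).
  by rewrite -(isog_cyclic (quotient1_isog G)); apply: cyclic_abelian.
have chi1: 'chi_j 1 = d%:R%R by case: (irr_d j) => // lin_j; rewrite lin_j in nlin_j.
have iZ: #|G : 'Z(G)| = (p ^ n)%N.
  by rewrite -divgS ?center_sub // oG oZ expnS mulKn ?prime_gt0.
have cod_n: d = p -> ((p ^ n)%:R)%R \in cod G.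
  move=> dp; have := mem_cod j; rewrite /codegree (trivgP fful_j) indexg1 oG.
  by rewrite chi1 dp expnSr natrM mulfK // pnatr_eq0 -lt0n prime_gt0.
have [n2 | n_neq2] := eqVneq n 2.
  suffices dp: d = p.
    split=> // i; rewrite n2 ltnS => lt_i; have ->: i = n by rewrite n2; lia.
    exact: cod_n.
  have [k] := irr1_pgroup j p_pr pG; rewrite chi1 => /eqP; rewrite eqr_nat => /eqP dk.
  have [+ _] := irr1_bound j; rewrite cfcenter_fful_irr // iZ chi1 dk n2.
  rewrite -natrX ler_nat -expnM leq_exp2l // => k_le1.
  case: k dk k_le1 => [|[|k]] dk k_le1; [|by rewrite expn1 | by move: k_le1; clear; lia].
  by case/negP: nlin_j; rewrite qualifE /= irr_char chi1 dk /=.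
have oQ: #|(G / 'Z(G))%G| = (p ^ n)%N by rewrite card_quotient ?gFnorm.
have clQ: nil_class (G / 'Z(G))%G = n.-1.
  by rewrite nil_class_quotient_center ?(pgroup_nil pG) // clG.
have n_gt2': 2 < n by rewrite ltn_neqAle eq_sym n_neq2.
have nsZG := center_normal G.
have [] := IHn _ _ oQ n_gt2' clQ => [i | dp codQ].
  by have := irr_d (mod_Iirr i); rewrite mod_IirrE // cfMod_lin_charE // cfMod1.
split=> // i /andP[i_gt1]; rewrite ltnS leq_eqVlt => /predU1P[-> | lt_in].
  exact: cod_n.
by apply: (cod_quotient nsZG); apply: codQ; rewrite i_gt1.
Qed.

Lemma cod_maxclass gT (p n : nat) (G : {group gT}) :
    prime p -> #|G| = (p ^ n)%N -> 1 < n -> nil_class G = n.-1 ->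
    size (cd G) = 2 ->
  cod G =i [seq ((p ^ i)%:R)%R | i <- iota 0 n].
Proof.
move=> p_pr oG n_gt1 clG cdG; have p_gt1 := prime_gt1 p_pr.
have pG: p.-group G by rewrite /pgroup oG pnatX pnat_id.
have cd_irr i : 'chi[G]_i 1 \in cd G.
  by rewrite mem_undup; apply/imageP; exists i.
have lin1 i : ('chi[G]_i \is a linear_char) = ('chi_i 1 == 1%R).
  by rewrite qualifE /= irr_char.
have ncG: ~~ abelian G.
  apply/negP=> /char_abelianP lin; suffices: size (cd G) <= size [:: 1%R : algC].
    by rewrite cdG.
  apply: uniq_leq_size (undup_uniq _) _ => x; rewrite mem_undup => /imageP[i _ ->].
  by rewrite inE -lin1.
have n_gt2: 2 < n by move: ncG; rewrite -nil_class1 clG -ltnNge; clear; lia.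
have [j nlin_j]: exists j : Iirr G, 'chi_j \isn't a linear_char.
  apply/existsP; apply: contraR ncG => /existsPn lin.
  by apply/char_abelianP=> i; have := lin i; rewrite negbK.
have [k def_d] := irr1_pgroup j p_pr pG.
have irr_d i : 'chi[G]_i \is a linear_char \/ 'chi_i 1 = ((p ^ k)%:R)%R.
  have [lin_i | nlin_i] := boolP ('chi_i \is a linear_char); [by left | right].
  rewrite -def_d; apply/eqP; apply: contraTT (leqnn 2) => neq_ij.
  rewrite -ltnNge -[X in _ < X]cdG.
  (* Two different nonlinear degrees would give three elements of [cd G]. *)
  apply: (@uniq_leq_size _ [:: 1%R; 'chi_i 1; 'chi_j 1]) => [|x].
    by rewrite /= !inE negb_or !(eq_sym 1%R) -!lin1 nlin_i nlin_j neq_ij.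
  rewrite !inE => /or3P[] /eqP-> //.
  by have := cd_irr 0%R; rewrite irr0 cfun11.
have [_ cod_gt1] := maxclass_mem_cod p_pr oG n_gt2 clG irr_d.
apply: cod_eq_noncyclic => // [|i lt_in].
  by apply: contra ncG; apply: cyclic_abelian.
(* The codegrees 1 and p come from a quotient of order p. *)
have [i_le1 | i_gt1] := leqP i 1; last by rewrite cod_gt1 ?i_gt1.
have [|N [_ nsNG oN]] := normal_pgroup (r := n.-1) pG (normal_refl G).
  by rewrite oG pfactorK // leq_pred.
have iN: #|G : N| = (p ^ 1)%N.
  rewrite -divgS ?normal_sub // oG oN -expnB ?prime_gt0 ?leq_pred //.
  by congr (p ^ _)%N; move: n_gt1; clear; lia.
apply: (@expr_mem_cod_cyclic p 1 i _ G N) => //.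
by rewrite prime_cyclic // card_quotient ?normal_norm // iN.
Qed.

End CodegreesOfGroups.

Theorem theoremA (p n : nat) (gT : finGroupType) (G : {group gT})
    (p_prime : prime p) (pG : p.-group G) (oG : #|G| = (p ^ n)%N)
    (n_ge2 : (2 <= n)%N) :
  cod G =i [seq (p ^ i)%:R | i <- iota 0 n] <->
  [\/ isog_Zdirect G (p ^ n.-1) p,
      [/\ isog_Zsemidirect G (p ^ n.-1) p, nil_class G = 2%N & (4 <= n)%N]
    | nil_class G = n.-1 /\ size (cd G) = 2%N].
Proof.
have p_gt1 := prime_gt1 p_prime.
have q_gt1 : (1 < p ^ n.-1)%N.
  by rewrite -(expn0 p) ltn_exp2l // -subn1 subn_gt0.
split=> [codG | [isoG | [isoG clG _] | [clG cdG]]]; last 1 first.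
- exact: cod_maxclass p_prime oG n_ge2 clG cdG.
- have [cGG | ncG] := boolP (abelian G).
    have ncG: ~~ cyclic G.
      by apply/(cod_noncyclic p_prime oG) => x; rewrite codG.
    have [|x Gx ox] := abelian_cod_expr_pred p_prime oG (ltnW n_ge2) cGG ncG.
      rewrite codG; apply/mem_expr_iota; exists n.-1 => //.
      by rewrite ltn_predL ltnW.
    by constructor 1; apply: abelian_maximal_exponent_isog ox.
  have [cdG _ _] := cod_pgroup_structure p_prime oG n_ge2 ncG codG.
  have [[[x Gx ox] cl2] | clG] :=
    cod_cyclic_maximal_or_maxclass p_prime oG n_ge2 codG; last by constructor 3.
  have [[clG isoG] | clG] := cyclic_maximal_nonabelian p_prime oG ncG Gx ox.
    have [n_gt3 | n_le3] := ltnP 3 n; first by constructor 2.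
    (* A nonabelian group has n > 2, so n = 3 and class 2 is already maximal. *)
    constructor 3; split=> //; rewrite clG.
    have: ~~ (n <= 2)%N.
      by apply: contra ncG => n_le2; rewrite (p2group_abelian pG) ?oG ?pfactorK.
    by move: n_le3; clear; lia.
  by constructor 3.
- have [cGG [C [Y [defG cycC cycY oC oY]]]] := isog_Zdirect_sdprod q_gt1 p_gt1 isoG.
  exact: cod_abelian_sdprod p_prime oG n_ge2 cGG defG cycC cycY oC oY.
have [C [Y [defG cycC cycY oC oY]]] := isog_Zsemidirect_sdprod q_gt1 p_gt1 isoG.
exact: cod_class2_sdprod p_prime oG clG defG cycC cycY oC oY.
Qed.
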